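(* Let $G$ be a finite abelian group. (a) If $\Gamma: R=\bigoplus_{g\in G}R_g$ is a real $G$-graded division algebra such that $\dim_{\mathbb R} R_e=2$ and $R_e$ is central in $R$, then there exists an alternating bicharacter $\beta: G\times G\to\mathbb{C}^\times$ such that $R$ is isomorphic, as a real $G$-graded algebra, to $\mathcal{P}(\beta)_{\mathbb R}$. (b) For alternating bicharacters $\beta,\beta':G\times G\to\mathbb{C}^\times$, $\mathcal{P}(\beta)_{\mathbb R}$ is isomorphic to $\mathcal{P}(\beta')_{\mathbb R}$ if and only if either $\beta'=\beta$ or $\beta'=\overline{\beta}$ (complex conjugate). (c) $\mathcal{P}(\beta)_{\mathbb R}$ is equivalent to $\mathcal{P}(\beta')_{\mathbb R}$ if and only if the orbit of $\beta'$ under the natural action of $\operatorname{Aut} G$ on alternating bicharacters contains $\beta$ or $\overline{\beta}$.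
   Context: All algebras are finite-dimensional, associative and unital. A $G$-graded algebra $R=\bigoplus_{g\in G}R_g$ ($G$ an abelian group with identity $e$, $R_gR_h\subset R_{gh}$) is a graded division algebra if every nonzero homogeneous element is invertible. The support $\{g: R_g\neq 0\}$ is always assumed to be all of $G$. A $G$-graded real algebra $R$ and a $G'$-graded real algebra $R'$, both graded division algebras, are equivalent if there are an isomorphism of $\mathbb R$-algebras $\varphi:R\to R'$ and a group isomorphism $\alpha:G\to G'$ with $\varphi(R_g)=R'_{\alpha(g)}$ for all $g\in G$; they are isomorphic if moreover $G=G'$ and $\alpha=\mathrm{id}_G$. A bicharacter $\beta:G\times G\to\mathbb C^\times$ is a map multiplicative in each argument; it is alternating if $\beta(g,g)=1$ for all $g$. For an alternating bicharacter $\beta$, $\mathcal P(\beta)$ denotes the (unique up to isomorphism of $G$-graded complex algebras) complex $G$-graded division algebra with support $G$, with one-dimensional (over $\mathbb C$) homogeneous components $\mathbb{C}X_g$, such that $X_gX_h=\beta(g,h)X_hX_g$ for all $g,h\in G$. $\mathcal P(\beta)_{\mathbb R}$ is the same $G$-graded algebra viewed as an algebra over $\mathbb R$. The group $\operatorname{Aut}G$ acts on alternating bicharacters by transport: $\alpha\in\operatorname{Aut}G$ sends $\beta$ to $(g,h)\mapsto\beta(\alpha^{-1}(g),\alpha^{-1}(h))$. *)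

(* Defs.v *)
From HB Require Import structures.
From mathcomp Require Import all_boot all_order all_algebra all_fingroup all_field.
From mathcomp Require Import complex.
From mathcomp Require Import reals.

Set Implicit Arguments.
Unset Strict Implicit.
Unset Printing Implicit Defensive.

Import GRing.Theory Num.Theory.
Local Open Scope ring_scope.
Local Open Scope complex_scope.

(* Alias of a complex algebra carrying the real algebra structure obtained by
   restriction of scalars along a |-> a%:C; its elements and its ring
   structure are those of the complex algebra. *)
Definition realification (R : realType) (P : algType R[i]) : Type := P.

Section Realification.
Variables (R : realType) (P : algType R[i]).

HB.instance Definition _ := GRing.NzRing.on (realification P).

Definition real_scale (a : R) (x : realification P) : realification P :=
  a%:C *: (x : P).

Fact real_scaleA a b x : real_scale a (real_scale b x) = real_scale (a * b) x.
Proof. by rewrite /real_scale scalerA rmorphM. Qed.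

Fact real_scale1 : left_id 1 real_scale.
Proof. by move=> x; rewrite /real_scale rmorph1 scale1r. Qed.

Fact real_scaleDr : right_distributive real_scale +%R.
Proof. by move=> a x y; rewrite /real_scale scalerDr. Qed.

Fact real_scaleDl x : {morph real_scale^~ x : a b / a + b}.
Proof. by move=> a b; rewrite /real_scale rmorphD scalerDl. Qed.

HB.instance Definition _ := GRing.Zmodule_isLmodule.Build R (realification P)
  real_scaleA real_scale1 real_scaleDr real_scaleDl.

Fact real_scaleAl (a : R) (x y : realification P) :
  a *: (x * y) = (a *: x) * y.
Proof. exact: (@scalerAl _ P). Qed.

HB.instance Definition _ :=
  GRing.Lmodule_isLalgebra.Build R (realification P) real_scaleAl.

Fact real_scaleAr (a : R) (x y : realification P) :
  a *: (x * y) = x * (a *: y).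
Proof. exact: (@scalerAr _ P). Qed.

HB.instance Definition _ :=
  GRing.Lalgebra_isAlgebra.Build R (realification P) real_scaleAr.

End Realification.

Record graded_division_algebra (F : fieldType) (gT : finGroupType)
    (A : falgType F) (A_ : gT -> {vspace A}) : Prop := {
  grading_sum : (\sum_(g : gT) A_ g)%VS = fullv;
  grading_direct : directv (\sum_(g : gT) A_ g);
  grading_mul : forall (g h : gT) (x y : A),
    x \in A_ g -> y \in A_ h -> x * y \in A_ (g * h)%g;
  grading_unit : forall (g : gT) (x : A),
    x \in A_ g -> x != 0 -> x \is a GRing.unit;
  grading_full_support : forall g : gT, A_ g != 0%VS
}.

(* Components are given as predicates rather than as {vspace _}, so that the
   C-subspaces grading a complex algebra are literally the components of its
   realification. *)
Definition graded_iso (F : fieldType) (gT gT' : finGroupType)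
    (A B : algType F) (A_ : gT -> {pred A}) (B_ : gT' -> {pred B})
    (alpha : gT -> gT') (phi : {lrmorphism A -> B}) : Prop :=
  bijective phi /\
  forall (g : gT) (y : B),
    y \in B_ (alpha g) <-> exists2 x : A, x \in A_ g & phi x = y.

Definition graded_isomorphic (F : fieldType) (gT : finGroupType)
    (A B : algType F) (A_ : gT -> {pred A}) (B_ : gT -> {pred B}) : Prop :=
  exists phi : {lrmorphism A -> B}, graded_iso A_ B_ id phi.

Definition graded_equivalent (F : fieldType) (gT gT' : finGroupType)
    (A B : algType F) (A_ : gT -> {pred A}) (B_ : gT' -> {pred B}) : Prop :=
  exists (alpha : {morphism [set: gT] >-> gT'}) (phi : {lrmorphism A -> B}),
    isom [set: gT] [set: gT'] alpha /\ graded_iso A_ B_ alpha phi.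

Record alternating_bicharacter (R : realType) (gT : finGroupType)
    (beta : gT -> gT -> R[i]) : Prop := {
  bichar_neq0 : forall g h, beta g h != 0;
  bichar_mull : forall g g' h, beta (g * g')%g h = beta g h * beta g' h;
  bichar_mulr : forall g h h', beta g (h * h')%g = beta g h * beta g h';
  bichar_alt : forall g, beta g g = 1
}.

(* The graded complex algebra (P, P_) is (a model of) P(beta). *)
Definition is_P (R : realType) (gT : finGroupType) (beta : gT -> gT -> R[i])
    (P : falgType R[i]) (P_ : gT -> {vspace P}) : Prop :=
  graded_division_algebra P_ /\
  exists X : gT -> P,
    (forall g, X g != 0 /\ P_ g = <[X g]>%VS) /\
    (forall g h, X g * X h = beta g h *: (X h * X g)).

Definition real_component (R : realType) (gT : finGroupType)
    (P : falgType R[i]) (P_ : gT -> {vspace P}) (g : gT) :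
    {pred realification P} := [pred x : P | x \in P_ g].

Definition conj_bichar (R : realType) (gT : finGroupType)
    (beta : gT -> gT -> R[i]) : gT -> gT -> R[i] :=
  fun g h => (beta g h)^*.

Definition aut_bichar (R : realType) (gT : finGroupType)
    (alpha : {perm gT}) (beta : gT -> gT -> R[i]) : gT -> gT -> R[i] :=
  fun g h => beta (alpha^-1%g g) (alpha^-1%g h).

Definition in_Aut_orbit (R : realType) (gT : finGroupType)
    (beta gamma : gT -> gT -> R[i]) : Prop :=
  exists2 alpha : {perm gT},
    alpha \in Aut [set: gT] & gamma =2 aut_bichar alpha beta.

(* Main.v *)
Require Import Defs.
From HB Require Import structures.
From mathcomp Require Import all_boot all_order all_algebra all_fingroup all_field.
From mathcomp Require Import spectral.
From mathcomp Require Import complex.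
From mathcomp Require Import boolp reals.

(** In a division algebra graded by an abelian group, with one-dimensional
    components over the base field, a choice of nonzero [X g] in each
    component is a basis whose multiplication is
    [X g * X h = sigma g h *: X (g * h)] for a 2-cocycle [sigma], and the
    commutation factor [beta g h = sigma g h / sigma h g] does not depend on
    the choice of [X].

    Classification (parts (b) and (c), [realification_iso_criterion]).  Let
    [phi] be a real isomorphism of realifications lying over an injective
    endomorphism [alpha] of [G].  It maps the neutral component, a copy of the
    complex numbers, onto the other one, hence sends ['i] to a square root of
    -1: [phi] is either complex linear or conjugate linear.  Applying [phi] to
    the commutation relations turns [beta] into [beta'] read along [alpha], or
    into its conjugate ([graded_iso_bichar]).  Conversely, let [s] be the
    identity or the conjugation, and suppose that [s] maps [beta] to [beta']
    read along [alpha].  The quotient of [s (sigma g h)] by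
    [sigma' (alpha g) (alpha h)] is then a symmetric cocycle, because the
    commutation factors cancel.  Such a cocycle on a finite abelian group is a
    coboundary ([symmetric_cocycle_coboundary]), so the basis of the target
    can be rescaled to have the structure constants [s (sigma g h)], and the
    [s]-semilinear map matching the bases is an isomorphism
    ([semilinear_extension]).  Part (b) is the case [alpha = id]; part (c) lets
    [alpha] range over the automorphisms of [G].

    Existence (part (a)).  The neutral component of [A] is a two-dimensional
    real division algebra, so it contains [J] with [J * J = -1]
    ([imaginary_unit]).  As [J] is central, it makes [A] a complex algebra
    ([complexification]) with the same ring structure and the same components,
    and these are complex lines ([homogeneous_complex_line]).  The commutation
    factor of this complex algebra is the bicharacter sought, and the identity
    of [A] is the isomorphism ([graded_division_complex]). *)

Set Implicit Arguments.
Unset Strict Implicit.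
Unset Printing Implicit Defensive.
Import Order.TTheory GRing.Theory Num.Theory.
Local Open Scope ring_scope.
Local Open Scope complex_scope.

(** * Graded division algebras *)

Section GradedDivisionAlgebra.
Variables (F : fieldType) (gT : finGroupType) (A : falgType F).
Variables (A_ : gT -> {vspace A}) (gdA : graded_division_algebra A_).

Lemma homogeneous_decomposition (x : A) :
  exists2 u : gT -> A, (forall g, u g \in A_ g) & x = \sum_g u g.
Proof.
have: x \in (\sum_g A_ g)%VS by rewrite (grading_sum gdA) memvf.
by case/memv_sumP=> u uA ->; exists u => // g; exact: uA.
Qed.

Lemma homogeneous_sum_eq0 (u : gT -> A) :
  (forall g, u g \in A_ g) -> \sum_g u g = 0 -> forall g, u g = 0.
Proof.
move=> uA u0 g.
exact: (directv_sum_independent (grading_direct gdA) u (fun h _ => uA h) u0).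
Qed.

Lemma homogeneous_sum_inj (u v : gT -> A) :
  (forall g, u g \in A_ g) -> (forall g, v g \in A_ g) ->
  \sum_g u g = \sum_g v g -> u =1 v.
Proof.
move=> uA vA /eqP; rewrite -subr_eq0 -sumrB => /eqP uv0 g.
apply/eqP; rewrite -subr_eq0; apply/eqP.
by apply: (homogeneous_sum_eq0 _ uv0) => h; rewrite rpredB.
Qed.

Lemma homogeneous_generators :
  exists X : gT -> A, forall g, X g \in A_ g /\ X g != 0.
Proof.
exists (fun g => vpick (A_ g)) => g.
by rewrite memv_pick vpick0 (grading_full_support gdA).
Qed.

Lemma homogeneous_mulf_neq0 g (x y : A) :
  x \in A_ g -> x != 0 -> y != 0 -> x * y != 0.
Proof.
move=> xA x0 y0; apply: contraNneq y0 => xy0.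
by rewrite -(mulKr (grading_unit gdA xA x0) y) xy0 mulr0.
Qed.

(** Multiplying the decomposition of [1] by a nonzero neutral [x] yields a
    homogeneous decomposition of [x]; comparing degrees, the neutral component
    of [1] already acts on the invertible [x] as [1] does. *)
Lemma mem1_grading : 1 \in A_ 1%g.
Proof.
have [X XP] := homogeneous_generators; have [x1 x0] := XP 1%g.
have [e eA e1] := homogeneous_decomposition 1.
have xu := grading_unit gdA x1 x0.
suff eq_x : (fun g => X 1%g * e g) =1 (fun g => if g == 1%g then X 1%g else 0).
  have := eq_x 1%g; rewrite eqxx => xe.
  by rewrite -[1](mulVr xu) -{2}xe mulKr.
apply: homogeneous_sum_inj => [g|g|].
- by rewrite -[g in A_ g]mul1g (grading_mul gdA).
- by case: eqP => [->|_]; rewrite ?mem0v.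
- by rewrite -big_mkcond big_pred1_eq -mulr_sumr -e1 mulr1.
Qed.

End GradedDivisionAlgebra.

(** * Symmetric cocycles are coboundaries *)

Section SymmetricCocycle.
Variables (C : numClosedFieldType) (gT : finGroupType).
Hypothesis abelG : abelian [set: gT].

Lemma mulgC_abelian (g h : gT) : (g * h = h * g)%g.
Proof. by apply: (centsP abelG); rewrite inE. Qed.

Variable tau : gT -> gT -> C.
Hypothesis tau_neq0 : forall g h, tau g h != 0.
Hypothesis tauC : forall g h, tau g h = tau h g.
Hypothesis tauA :
  forall g h k, tau g h * tau (g * h)%g k = tau h k * tau g (h * k)%g.

(** The matrix, acting on row vectors, of [e_k |-> tau g k *: e_(g * k)]: the
    regular representation of the group algebra of [gT] twisted by [tau]. *)
Definition twisted_translation g : 'M[C]_#|gT| :=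
  \matrix_(i, j) if enum_val j == (g * enum_val i)%g
                 then tau g (enum_val i) else 0.

Lemma twisted_translation_mull g (N : 'M[C]_#|gT|) i j :
  (twisted_translation g *m N) i j =
    tau g (enum_val i) * N (enum_rank (g * enum_val i)%g) j.
Proof.
rewrite mxE (bigD1 (enum_rank (g * enum_val i)%g)) //= mxE enum_rankK eqxx.
rewrite big1 ?addr0 // => k; rewrite mxE -(inj_eq enum_val_inj) enum_rankK.
by move/negPf->; rewrite mul0r.
Qed.

Lemma twisted_translation_mul g h :
  twisted_translation h *m twisted_translation g =
    tau g h *: twisted_translation (g * h)%g.
Proof.
apply/matrixP=> i j; rewrite twisted_translation_mull !mxE enum_rankK mulgA.
by case: eqP; rewrite ?mulr0 // tauA.
Qed.

(** The twisted group algebra of a symmetric cocycle on an abelian group is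
    commutative, so its regular representation has a common eigenvector; the
    eigenvalues [lambda g] obey the multiplication rule of the algebra.  This
    replaces the usual argument through the divisibility of the unit group. *)
Lemma symmetric_cocycle_coboundary :
  exists lambda : gT -> C, (forall g, lambda g != 0) /\
    forall g h, lambda g * lambda h = tau g h * lambda (g * h)%g.
Proof.
pose T := twisted_translation.
have cT : {in codom T &, forall A B, comm_mx A B}.
  move=> _ _ /codomP[g ->] /codomP[h ->].
  by rewrite /comm_mx !twisted_translation_mul tauC mulgC_abelian.
have [|v v0 /allP vT] := common_eigenvector _ cT.
  by apply/card_gt0P; exists 1%g.
have /choice[lambda lambdaE] : forall g, exists a, v *m T g = a *: v.
  by move=> g; apply/sub_rVP; apply: vT; apply: codom_f.
have lambdaM g h : lambda g * lambda h = tau g h * lambda (g * h)%g.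
  have /eqP : (lambda g * lambda h - tau g h * lambda (g * h)%g) *: v = 0.
    rewrite scalerBl -2!scalerA -!lambdaE [tau _ _ *: _]scalemxAr.
    rewrite -twisted_translation_mul mulmxA lambdaE -scalemxAl lambdaE.
    by rewrite scalerA mulrC -scalerA -lambdaE subrr.
  by rewrite scaler_eq0 (negPf v0) orbF subr_eq0 => /eqP.
(* If one eigenvalue vanishes then so does that of the neutral element, whose
   matrix is diagonal with nonzero entries: this would force [v = 0]. *)
exists lambda; split=> // g; apply: contraNneq v0 => lg0.
have l10 : lambda 1%g = 0.
  apply/eqP; have := lambdaM g g^-1%g; rewrite lg0 mul0r mulgV => /esym/eqP.
  by rewrite mulf_eq0 (negPf (tau_neq0 _ _)).
apply/eqP/rowP=> j; have := congr1 (fun u : 'rV_#|gT| => u 0 j) (lambdaE 1%g).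
rewrite l10 scale0r !mxE (bigD1 j) //= big1 => [|k kj].
  rewrite addr0 mxE mul1g eqxx => /eqP.
  by rewrite mulf_eq0 (negPf (tau_neq0 _ _)) orbF => /eqP.
by rewrite mxE mul1g (inj_eq enum_val_inj) eq_sym (negPf kj) mulr0.
Qed.

End SymmetricCocycle.

(** * Building algebra morphisms and bases *)

Section LRMorphism.
Variables (F : fieldType) (A B : algType F) (f : A -> B).
Hypotheses (f_linear : linear f) (f_mul : {morph f : x y / x * y}).
Hypothesis f1 : f 1 = 1.

Definition lrmorphism_fun : A -> B := f.
HB.instance Definition _ :=
  GRing.isLinear.Build F A B _ lrmorphism_fun f_linear.
HB.instance Definition _ :=
  GRing.isMonoidMorphism.Build A B lrmorphism_fun (f1, f_mul).

Lemma lrmorphism_of_fun : exists phi : {lrmorphism A -> B}, phi =1 f.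
Proof. by exists lrmorphism_fun. Qed.

End LRMorphism.

Lemma inj_surj_bij (T U : Type) (f : T -> U) :
  injective f -> (forall y, exists x, f x = y) -> bijective f.
Proof.
move=> inj_f /choice[f' f'K]; exists f' => // x; exact/inj_f.
Qed.

Lemma vector_axiom_of_basis (F : fieldType) (I : finType) (V : lmodType F)
    (X : I -> V) :
  (forall x, exists c : I -> F, x = \sum_i c i *: X i) ->
  (forall c : I -> F, \sum_i c i *: X i = 0 -> forall i, c i = 0) ->
  Vector.axiom #|I| V.
Proof.
move=> X_span X_free.
pose f (r : 'rV[F]_#|I|) := \sum_i r 0 (enum_rank i) *: X i.
have f_lin : linear f.
  move=> a u v; rewrite /f scaler_sumr -big_split; apply: eq_bigr => i _ /=.
  by rewrite !mxE scalerDl scalerA.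
pose f' : {linear 'rV[F]_#|I| -> V} :=
  HB.pack f (GRing.isLinear.Build F _ V _ f f_lin).
have f_inj : injective f'.
  apply: raddf_inj => r /X_free r0; apply/rowP => j.
  by rewrite mxE -[j]enum_valK r0.
have /choice[g gK] : forall x, exists r, f' r = x.
  move=> x; have [c ->] := X_span x; exists (\row_j c (enum_val j)).
  by apply: eq_bigr => i _; rewrite mxE enum_rankK.
have fK : cancel f' g by move=> r; apply: f_inj; rewrite gK.
exists g; first exact: (can2_linear fK gK).
by exists f'.
Qed.

(** * Gradings by lines *)

Section HomogeneousBasis.
Variables (F : fieldType) (gT : finGroupType) (A : falgType F).
Variables (A_ : gT -> {vspace A}) (gdA : graded_division_algebra A_).
Variables (X : gT -> A) (XP : forall g, X g != 0 /\ A_ g = <[X g]>%VS).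

Lemma hbasis_mem g : X g \in A_ g.
Proof. by have [_ ->] := XP g; apply: memv_line. Qed.

Lemma hbasis_span (x : A) : exists c : gT -> F, x = \sum_g c g *: X g.
Proof.
have [u uA ->] := homogeneous_decomposition gdA x.
have /choice[c cE] : forall g, exists a, u g = a *: X g.
  by move=> g; apply/vlineP; rewrite -(XP g).2.
by exists c; apply: eq_bigr => g _.
Qed.

Lemma hbasis_free (c : gT -> F) : \sum_g c g *: X g = 0 -> forall g, c g = 0.
Proof.
move=> c0 g; have /eqP := homogeneous_sum_eq0 gdA
  (fun h => memvZ (c h) (hbasis_mem h)) c0 g.
by rewrite scaler_eq0 (negPf (XP g).1) orbF => /eqP.
Qed.

Lemma hbasis_mul : exists sigma : gT -> gT -> F,
  (forall g h, sigma g h != 0) /\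
  forall g h, X g * X h = sigma g h *: X (g * h)%g.
Proof.
have /choice[sigma sigmaE] : forall p : gT * gT,
    exists a, X p.1 * X p.2 = a *: X (p.1 * p.2)%g.
  move=> p; apply/vlineP; rewrite -(XP _).2.
  by apply: (grading_mul gdA); apply: hbasis_mem.
exists (fun g h => sigma (g, h)); split=> [g h|g h]; last exact: sigmaE (g, h).
have := homogeneous_mulf_neq0 gdA (hbasis_mem g) (XP g).1 (XP h).1.
by apply: contraNneq => s0; rewrite (sigmaE (g, h)) s0 scale0r.
Qed.

(** Associativity of the product of three basis elements. *)
Lemma hbasis_cocycle (sigma : gT -> gT -> F) :
  (forall g h, X g * X h = sigma g h *: X (g * h)%g) ->
  forall g h k,
    sigma g h * sigma (g * h)%g k = sigma h k * sigma g (h * k)%g.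
Proof.
move=> XM g h k; apply/eqP; rewrite -subr_eq0.
have /eqP : (sigma g h * sigma (g * h)%g k - sigma h k * sigma g (h * k)%g)
    *: X (g * h * k)%g = 0.
  rewrite scalerBl -2!scalerA -XM -mulgA -XM.
  by rewrite scalerAl -XM scalerAr -XM mulrA subrr.
by rewrite scaler_eq0 (negPf (XP _).1) orbF.
Qed.

Lemma hbasis_commutation_mull (beta : gT -> gT -> F) :
  (forall g h, X g * X h = beta g h *: (X h * X g)) ->
  forall g g' h, beta (g * g')%g h = beta g h * beta g' h.
Proof.
move=> XC g g' h; have [sigma [sigma0 XM]] := hbasis_mul.
have XXX : X g * X g' * X h = beta (g * g')%g h *: (X h * (X g * X g')).
  by rewrite XM -scalerAr -scalerAl scalerA mulrC -scalerA -XC.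
apply/eqP; rewrite -subr_eq0.
have /eqP : (beta (g * g')%g h - beta g h * beta g' h) *:
    (X h * (X g * X g')) = 0.
  rewrite scalerBl -XXX -mulrA XC -scalerAr !mulrA (XC g h) -scalerAl scalerA.
  by rewrite [beta g' h * _]mulrC subrr.
rewrite scaler_eq0 XM -scalerAr scaler_eq0 (negPf (sigma0 _ _)) /=.
have hX := homogeneous_mulf_neq0 gdA (hbasis_mem h) (XP h).1 (XP (g * g')%g).1.
by rewrite (negPf hX) orbF.
Qed.

End HomogeneousBasis.

(** * Semilinear isomorphisms of realifications *)

Section SemilinearExtension.
Variables (R : realType) (gT : finGroupType) (P P' : algType R[i]).
Variables (X : gT -> P) (Y : gT -> P').
Hypothesis X_span : forall x, exists c : gT -> R[i], x = \sum_g c g *: X g.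
Hypothesis X_free :
  forall c : gT -> R[i], \sum_g c g *: X g = 0 -> forall g, c g = 0.
Hypothesis Y_span : forall x, exists c : gT -> R[i], x = \sum_g c g *: Y g.
Hypothesis Y_free :
  forall c : gT -> R[i], \sum_g c g *: Y g = 0 -> forall g, c g = 0.
Variables (s : {rmorphism R[i] -> R[i]}) (sigma : gT -> gT -> R[i]).
Hypotheses (sK : involutive s) (s_real : forall a : R, s a%:C = a%:C).
Hypothesis X_mul : forall g h, X g * X h = sigma g h *: X (g * h)%g.
Hypothesis Y_mul : forall g h, Y g * Y h = s (sigma g h) *: Y (g * h)%g.

(** With [s] the identity or the conjugation, the [s]-semilinear map sending one
    basis to another is real linear, and multiplicative once the structure
    constants correspond under [s].  Treating [s] abstractly deals with the
    linear and the conjugate-linear isomorphisms together. *)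
Lemma semilinear_extension :
  exists phi : {lrmorphism realification P -> realification P'},
    bijective phi /\ forall c g, phi (c *: X g : P) = s c *: Y g.
Proof.
have [c cE] := choice X_span.
pose f x : P' := \sum_g s (c x g) *: Y g.
have fE (d : gT -> R[i]) : f (\sum_g d g *: X g) = \sum_g s (d g) *: Y g.
  apply: eq_bigr => g _; congr (s _ *: _); apply/eqP; rewrite -subr_eq0.
  apply/eqP; apply: (X_free (c := fun g => c _ g - d g)).
  under eq_bigr do rewrite scalerBl.
  by rewrite sumrB -cE subrr.
have fD : {morph f : x y / x + y}.
  move=> x y; rewrite [in LHS](cE x) [in LHS](cE y) -big_split /=.
  under eq_bigr do rewrite -scalerDl.
  by rewrite fE -big_split; apply: eq_bigr => g _; rewrite rmorphD scalerDl.
have fZ a x : f (a *: x) = s a *: f x.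
  rewrite [in LHS](cE x) scaler_sumr; under eq_bigr do rewrite scalerA.
  rewrite fE scaler_sumr; apply: eq_bigr => g _.
  by rewrite rmorphM scalerA.
have f0 : f 0 = 0 by rewrite -[0 in LHS](scale0r 0) fZ rmorph0 scale0r.
have f_sum (u : gT -> P) : f (\sum_g u g) = \sum_g f (u g).
  exact: (big_morph f fD f0).
have fX g : f (X g) = Y g.
  have -> : X g = \sum_h (if h == g then 1 else 0) *: X h.
    rewrite (bigD1 g) //= eqxx scale1r big1 ?addr0 // => h /negPf->.
    by rewrite scale0r.
  rewrite fE (bigD1 g) //= eqxx rmorph1 scale1r big1 ?addr0 // => h /negPf->.
  by rewrite rmorph0 scale0r.
have fM : {morph f : x y / x * y}.
  move=> x y; rewrite (cE x) (cE y) mulr_suml !f_sum mulr_suml.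
  apply: eq_bigr => g _; rewrite mulr_sumr f_sum mulr_sumr.
  apply: eq_bigr => h _; rewrite !(fZ, fX, =^~ scalerAl, =^~ scalerAr).
  by rewrite X_mul Y_mul !(fZ, fX).
have f_inj : injective f.
  move=> x y fxy; apply/eqP; rewrite -subr_eq0; apply/eqP.
  have: f (x - y) = 0 by rewrite fD fxy -scaleN1r fZ rmorphN1 scaleN1r subrr.
  move/(Y_free (c := fun g => s (c (x - y) g))) => c0.
  rewrite (cE (x - y)) big1 // => g _.
  by rewrite -[c _ g]sK c0 rmorph0 scale0r.
have f_surj y : exists x, f x = y.
  have [d ->] := Y_span y; exists (\sum_g s (d g) *: X g).
  by rewrite fE; apply: eq_bigr => g _; rewrite sK.
(* A surjective multiplicative map preserves the unit, which saves computing the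
   coordinates of [1]. *)
have f1 : f 1 = 1.
  by have [x fx] := f_surj 1; rewrite -[f 1]mulr1 -fx -fM mul1r.
have f_lin : linear (f : realification P -> realification P').
  by move=> a x y; rewrite fD fZ s_real.
have [phi phiE] := lrmorphism_of_fun f_lin fM f1.
exists phi; split=> [|a g]; last by rewrite phiE fZ fX.
apply: (eq_bij (f := f)) => [|x]; last by rewrite phiE.
exact: inj_surj_bij.
Qed.

End SemilinearExtension.

(** * Isomorphism criterion *)

Section Criterion.
Variables (R : realType) (gT : finGroupType).
Hypothesis abelG : abelian [set: gT].

Lemma hbasis_commutation (F : fieldType) (A : algType F) (X : gT -> A)
    (beta sigma : gT -> gT -> F) :
  (forall g, X g != 0) ->
  (forall g h, X g * X h = beta g h *: (X h * X g)) ->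
  (forall g h, X g * X h = sigma g h *: X (g * h)%g) ->
  forall g h, sigma g h = beta g h * sigma h g.
Proof.
move=> X0 XC XM g h; apply/eqP; rewrite -subr_eq0.
have /eqP : (sigma g h - beta g h * sigma h g) *: X (g * h)%g = 0.
  rewrite scalerBl -scalerA -XM [in sigma h g *: _](mulgC_abelian abelG).
  by rewrite -XM XC subrr.
by rewrite scaler_eq0 (negPf (X0 _)) orbF.
Qed.

Variables (beta beta' : gT -> gT -> R[i]).
Variables (P : falgType R[i]) (P_ : gT -> {vspace P}).
Variables (P' : falgType R[i]) (P'_ : gT -> {vspace P'}).
Hypotheses (isP : is_P beta P_) (isP' : is_P beta' P'_).
Variable alpha : gT -> gT.
Hypothesis alphaM : {morph alpha : g h / (g * h)%g}.
Hypothesis inj_alpha : injective alpha.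

(** The quotient [tau] of the two cocycles, transported by [s] and [alpha], is
    symmetric exactly because the commutation factors agree; trivialising [tau]
    provides the scalars [mu] that align the two bases. *)
Lemma semilinear_graded_iso (s : {rmorphism R[i] -> R[i]}) :
  involutive s -> (forall a : R, s a%:C = a%:C) ->
  (forall g h, beta' (alpha g) (alpha h) = s (beta g h)) ->
  exists phi : {lrmorphism realification P -> realification P'},
    graded_iso (real_component P_) (real_component P'_) alpha phi.
Proof.
move=> sK s_real betaE.
have [gd [X [XP XC]]] := isP; have [gd' [X' [XP' XC']]] := isP'.
have [sigma [sigma0 XM]] := hbasis_mul gd XP.
have [sigma' [sigma'0 XM']] := hbasis_mul gd' XP'.
have sigmaC := hbasis_commutation (fun g => (XP g).1) XC XM.
have sigmaC' := hbasis_commutation (fun g => (XP' g).1) XC' XM'.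
pose tau g h := s (sigma g h) / sigma' (alpha g) (alpha h).
have tau0 g h : tau g h != 0.
  by rewrite mulf_neq0 ?invr_eq0 ?fmorph_eq0.
have tauC g h : tau g h = tau h g.
  rewrite /tau sigmaC sigmaC' rmorphM -betaE invfM mulrACA divff ?mul1r //.
  apply: contraNneq (sigma'0 (alpha g) (alpha h)) => b0.
  by rewrite sigmaC' b0 mul0r.
have tauA g h k :
    tau g h * tau (g * h)%g k = tau h k * tau g (h * k)%g.
  rewrite /tau mulrACA [RHS]mulrACA -!rmorphM -!invfM !alphaM.
  by rewrite (hbasis_cocycle XP XM) (hbasis_cocycle XP' XM').
have [mu [mu0 muM]] := symmetric_cocycle_coboundary abelG tau0 tauC tauA.
pose Y g := mu g *: X' (alpha g).
have YM g h : Y g * Y h = s (sigma g h) *: Y (g * h)%g.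
  rewrite /Y -scalerAl -scalerAr XM' !scalerA muM alphaM mulrAC.
  by rewrite /tau divfK // .
have Y_span y : exists c : gT -> R[i], y = \sum_g c g *: Y g.
  have [c ->] := hbasis_span gd' XP' y.
  exists (fun g => c (alpha g) / mu g); rewrite (reindex_inj inj_alpha) /=.
  by apply: eq_bigr => g _; rewrite scalerA divfK.
have Y_free (c : gT -> R[i]) :
    \sum_g c g *: Y g = 0 -> forall g, c g = 0.
  pose a' := invF inj_alpha; pose d h := c (a' h) * mu (a' h).
  move=> c0 g; have : d (alpha g) = 0.
    apply: (hbasis_free gd' XP'); rewrite (reindex_inj inj_alpha) -[RHS]c0 /=.
    by apply: eq_bigr => h _; rewrite /d /a' invF_f scalerA.
  rewrite /d /a' invF_f => /eqP.
  by rewrite mulf_eq0 (negPf (mu0 g)) orbF => /eqP.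
have [phi [bij_phi phiE]] := semilinear_extension (hbasis_span gd XP)
  (hbasis_free gd XP) Y_span Y_free sK s_real XM YM.
exists phi; split=> // g y; split=> [|[x]].
- rewrite inE (XP' _).2 => /vlineP[a ->]; exists (s (a / mu g) *: X g : P).
    by rewrite inE (XP _).2; apply/vlineP; exists (s (a / mu g)).
  by rewrite phiE sK scalerA divfK.
- rewrite !inE (XP _).2 (XP' _).2 => /vlineP[a ->] <-; rewrite phiE scalerA.
  by apply/vlineP; exists (s a * mu g).
Qed.

(** The neutral component is a line containing [1], hence the scalars. *)
Lemma mem1_line (x : P') : x \in P'_ 1%g -> exists d, x = d *: 1.
Proof.
have [gd' [X' [XP' _]]] := isP'; have := mem1_grading gd'.
rewrite (XP' _).2 => /vlineP[b b1] /vlineP[a ->].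
exists (a / b); rewrite b1 scalerA divfK //.
by apply: contraNneq (oner_neq0 P') => b0; rewrite b1 b0 scale0r.
Qed.

(** The scalar [d] by which [phi] replaces ['i] is a square root of -1, and its
    sign decides whether [phi] is linear or conjugate linear. *)
Lemma graded_iso_bichar
    (phi : {lrmorphism realification P -> realification P'}) :
  graded_iso (real_component P_) (real_component P'_) alpha phi ->
  (forall g h, beta' (alpha g) (alpha h) = beta g h) \/
  (forall g h, beta' (alpha g) (alpha h) = (beta g h)^*).
Proof.
case=> bij_phi phi_gr.
have [gd [X [XP XC]]] := isP; have [gd' [X' [XP' XC']]] := isP'.
pose f (x : P) : P' := phi x.
have f_mem g x : x \in P_ g -> f x \in P'_ (alpha g).
  by move=> xg; apply/phi_gr; exists x.
have fD x y : f (x + y) = f x + f y by exact: (rmorphD phi).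
have f0 : f 0 = 0 by exact: (rmorph0 phi).
have fM x y : f (x * y) = f x * f y by exact: (rmorphM phi).
have fN1 : f (- 1) = - 1 by exact: (rmorphN1 phi).
have f_inj : injective f by exact: (bij_inj bij_phi).
have fZ (a : R) x : f (a%:C *: x) = a%:C *: f x.
  exact: (linearZ_LR phi a (x : realification P)).
have alpha1 : alpha 1%g = 1%g.
  by apply: (mulgI (alpha 1%g)); rewrite -alphaM !mulg1.
have [d f_i] : exists d, f ('i *: 1) = d *: 1.
  apply: mem1_line; rewrite -alpha1; apply: f_mem.
  by apply: memvZ; apply: mem1_grading.
have d2 : d * d = -1.
  apply/eqP; rewrite -subr_eq0.
  have /eqP : (d * d - -1) *: (1 : P') = 0.
    rewrite scalerBl scaleN1r -fN1; apply/eqP; rewrite subr_eq0; apply/eqP.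
    have <- : ('i *: 1 : P) * ('i *: 1) = - 1.
      by rewrite -scalerAl mul1r scalerA -expr2 sqrCi scaleN1r.
    by rewrite fM f_i -scalerAl mul1r scalerA.
  by rewrite scaler_eq0 oner_eq0 orbF.
have {d2} d_i : d = 'i \/ d = - 'i.
  have /eqP : (d - 'i) * (d + 'i) = 0.
    by rewrite -subr_sqr expr2 d2 sqrCi subrr.
  by rewrite mulf_eq0 subr_eq0 addr_eq0 => /orP[]/eqP; [left|right].
have fC (s : R[i] -> R[i]) c x :
    (forall a b : R, s (a +i* b) = a%:C + b%:C * d) -> f (c *: x) = s c *: f x.
  move=> sE; have -> : c *: x =
      (complex.Re c)%:C *: x + (complex.Im c)%:C *: (('i *: 1) * x).
    rewrite -scalerAl mul1r scalerA -scalerDl; congr (_ *: _).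
    by rewrite [LHS]complexE mulrC complexiE.
  rewrite fD !fZ fM f_i.
  by rewrite -scalerAl mul1r scalerA -scalerDl -sE; case: c.
have betaE (s : R[i] -> R[i]) :
    (forall a b : R, s (a +i* b) = a%:C + b%:C * d) ->
    forall g h, beta' (alpha g) (alpha h) = s (beta g h).
  move=> /fC fC' g h.
  have fX k : exists a, f (X k) = a *: X' (alpha k).
    apply/vlineP; rewrite -(XP' _).2; apply: f_mem.
    exact: (hbasis_mem XP k).
  have [a aE] := fX g; have [b bE] := fX h.
  apply/eqP; rewrite -subr_eq0.
  have /eqP : (beta' (alpha g) (alpha h) - s (beta g h)) *:
      f (X h * X g) = 0.
    rewrite scalerBl -fC' -XC !fM aE bE.
    rewrite -!scalerAl -!scalerAr [X' (alpha g) * _]XC' !scalerA.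
    by rewrite -mulrA mulrC [b * a]mulrC subrr.
  rewrite scaler_eq0 => /orP[//|]; rewrite -f0.
  rewrite (inj_eq f_inj) => /eqP XX0.
  have := homogeneous_mulf_neq0 gd (hbasis_mem XP h) (XP h).1 (XP g).1.
  by rewrite XX0 eqxx.
case: d_i => dE; [left|right] => g h.
  by apply: (betaE idfun) => a b; rewrite dE [LHS]complexE complexiE mulrC.
apply: (betaE (@conjc R)) => a b.
by rewrite dE -complexiE; simpc.
Qed.

Lemma realification_iso_criterion :
  (exists phi : {lrmorphism realification P -> realification P'},
    graded_iso (real_component P_) (real_component P'_) alpha phi) <->
  (forall g h, beta' (alpha g) (alpha h) = beta g h) \/
  (forall g h, beta' (alpha g) (alpha h) = (beta g h)^*).
Proof.
split=> [[phi /graded_iso_bichar]//|[]].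
  exact: (@semilinear_graded_iso idfun).
by apply: (@semilinear_graded_iso (@conjc R)); [exact: conjcK|exact: conjc_real].
Qed.

End Criterion.

(** * The complex structure given by a central square root of -1 *)

Section Complexification.
Variables (R : realType) (A : falgType R) (J : A).
Hypotheses (J2 : J * J = -1) (JC : forall x, J * x = x * J).

Definition complex_embed (z : R[i]) : A := (complex.Re z)%:A + complex.Im z *: J.

Lemma complex_embedD z w :
  complex_embed (z + w) = complex_embed z + complex_embed w.
Proof.
by case: z w => [a b] [c d]; rewrite /complex_embed /= !scalerDl addrACA.
Qed.

Lemma complex_embedM z w :
  complex_embed (z * w) = complex_embed z * complex_embed w.
Proof.
case: z w => [a b] [c d]; rewrite /complex_embed /= mulrDl !mulrDr.
rewrite -!scalerAl -!scalerAr !mul1r mulr1 J2 !scalerA scalerN.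
by rewrite scalerBl scalerDl addrACA -addrA [- _ + _]addrC !addrA.
Qed.

Lemma complex_embed_real a : complex_embed a%:C = a%:A.
Proof. by rewrite /complex_embed /= scale0r addr0. Qed.

Lemma complex_embedC z x : complex_embed z * x = x * complex_embed z.
Proof.
by rewrite /complex_embed mulrDl mulrDr -!scalerAl -!scalerAr JC mul1r mulr1.
Qed.

(** The proofs are parameters of the type so that the instances of its algebra
    structures, which depend on them, can be inferred. *)
Definition complexification (_ : J * J = -1) (_ : forall x, J * x = x * J) :
  Type := A.

Local Notation B := (complexification J2 JC).

HB.instance Definition _ := GRing.UnitRing.on B.

Definition complex_scale (z : R[i]) (x : B) : B :=
  complex_embed z * x.

Fact complex_scaleA z w x :
  complex_scale z (complex_scale w x) = complex_scale (z * w) x.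
Proof. by rewrite /complex_scale complex_embedM mulrA. Qed.

Fact complex_scale1 : left_id 1 complex_scale.
Proof.
by move=> x; rewrite /complex_scale (complex_embed_real 1) scale1r mul1r.
Qed.

Fact complex_scaleDr : right_distributive complex_scale +%R.
Proof. by move=> z x y; rewrite /complex_scale mulrDr. Qed.

Fact complex_scaleDl x : {morph complex_scale^~ x : z w / z + w}.
Proof. by move=> z w; rewrite /complex_scale complex_embedD mulrDl. Qed.

HB.instance Definition _ := GRing.Zmodule_isLmodule.Build R[i] B
  complex_scaleA complex_scale1 complex_scaleDr complex_scaleDl.

Fact complex_scaleAl (z : R[i]) (x y : B) :
  z *: (x * y) = (z *: x) * y.
Proof. exact: mulrA. Qed.

HB.instance Definition _ :=
  GRing.Lmodule_isLalgebra.Build R[i] B complex_scaleAl.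

Fact complex_scaleAr (z : R[i]) (x y : B) :
  z *: (x * y) = x * (z *: y).
Proof. by rewrite [LHS]mulrA complex_embedC -mulrA. Qed.

HB.instance Definition _ :=
  GRing.Lalgebra_isAlgebra.Build R[i] B complex_scaleAr.

End Complexification.

(** Take [x] outside the real line of [1], so that [1] and [x] span the neutral
    component, and complete the square: [y = x - k] has a real square [c].  If
    [c] were nonnegative, [y * y - c] would factor into homogeneous elements
    that are nonzero, hence invertible; so [c < 0] and [y] can be normalised. *)
Lemma imaginary_unit (R : realType) (gT : finGroupType) (A : falgType R)
    (A_ : gT -> {vspace A}) :
  graded_division_algebra A_ -> \dim (A_ 1%g) = 2%N ->
  exists J : A, [/\ J \in A_ 1%g, J * J = -1
    & forall x, x \in A_ 1%g -> exists z, x = complex_embed J z].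
Proof.
move=> gd dim2; have A1 := mem1_grading gd.
have A11 (a : R) : a%:A \in A_ 1%g by rewrite memvZ.
have /subvPn[x xA xN1] : ~~ (A_ 1%g <= <[1]>)%VS.
  by apply/negP => /dimvS; rewrite dim2 dim_vline oner_neq0.
have xM : x * x \in A_ 1%g by rewrite -[1%g]mulg1 (grading_mul gd).
have A_span y : y \in A_ 1%g -> exists a b : R, y = a%:A + b *: x.
  have <- : <<[:: x; 1%R]>>%VS = A_ 1%g.
    apply/eqP; rewrite eqEdim; apply/andP; split.
      by apply/span_subvP => z; rewrite !inE => /orP[]/eqP->.
    have -> : \dim <<[:: x; 1%R]>> = 2%N; last by rewrite dim2.
    by apply/eqP; rewrite [_ == _]free_cons span_seq1 xN1 seq1_free oner_neq0.
  rewrite span_cons span_seq1 => /memv_addP[_ /vlineP[b ->]].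
  by case=> _ /vlineP[a ->] ->; exists a, b; rewrite addrC.
have [a [b xE]] := A_span _ xM.
pose k := b / 2; pose y := x - k%:A; pose c := a + k * k.
have shiftA (e : R) : y + e%:A \in A_ 1%g by rewrite rpredD // rpredB.
have shift_neq0 (e : R) : y + e%:A != 0.
  apply: contraNneq xN1 => /eqP.
  rewrite -addrA addr_eq0 opprD opprK => /eqP->.
  by rewrite rpredB // memvZ ?memv_line.
have y2 : y * y = c%:A.
  rewrite mulrBl !mulrBr xE -!(scalerAl, scalerAr) !(mul1r, mulr1) !scalerA.
  have -> : b *: x = k *: x + k *: x by rewrite -scalerDl -splitr.
  by rewrite opprB [_%:A + (_ + _)]addrA addrK addrACA subrr addr0 -scalerDl.
have c_lt0 : c < 0.
  rewrite ltNge; apply/negP => c0; pose r := Num.sqrt c.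
  have := homogeneous_mulf_neq0 gd (shiftA r) (shift_neq0 r) (shift_neq0 (- r)).
  rewrite mulrDl [y * _]mulrDr [_%:A * _]mulrDr y2 -!(scalerAl, scalerAr).
  rewrite !(mul1r, mulr1) !scalerA mulrN.
  by rewrite -expr2 sqr_sqrtr // !scaleNr addrA subrK subrr eqxx.
pose r := Num.sqrt (- c).
have r0 : r != 0 by rewrite sqrtr_eq0 -ltNge oppr_gt0.
exists (r^-1 *: y); split.
- by rewrite memvZ // rpredB.
- rewrite -scalerAl -scalerAr y2 !scalerA -invfM -expr2.
  rewrite sqr_sqrtr ?oppr_ge0 ?ltW //.
  by rewrite invrN mulNr mulVf ?lt_eqF // scaleN1r.
- move=> z /A_span[d [e ->]]; exists ((d + e * k) +i* (e * r)).
  rewrite /complex_embed /= scalerA mulfK // scalerBr scalerA scalerDl.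
  by rewrite addrCA addrK addrC.
Qed.

(** * Existence of the bicharacter *)

Section ComplexStructure.
Variables (R : realType) (gT : finGroupType).
Hypothesis abelG : abelian [set: gT].
Variables (A : falgType R) (A_ : gT -> {vspace A}).
Hypothesis gd : graded_division_algebra A_.
Variable J : A.
Hypotheses (JA : J \in A_ 1%g) (J2 : J * J = -1) (JC : forall x, J * x = x * J).
Hypothesis J_span : forall x, x \in A_ 1%g -> exists z, x = complex_embed J z.
Variable X : gT -> A.
Hypotheses (XA : forall g, X g \in A_ g) (X0 : forall g, X g != 0).

Local Notation e := (complex_embed J).

Lemma complex_embed_mem1 z : e z \in A_ 1%g.
Proof. by rewrite rpredD // memvZ // (mem1_grading gd). Qed.

Lemma complex_embed1 : e 1 = 1.
Proof. by rewrite (complex_embed_real J 1) scale1r. Qed.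

Lemma complex_embed_eq0 z : (e z == 0) = (z == 0).
Proof.
apply/eqP/eqP => [ez0|->]; last by rewrite (complex_embed_real J 0) scale0r.
apply: contra_eq (oner_neq0 A) => z0.
by rewrite -complex_embed1 -(divff z0) complex_embedM // ez0 mul0r eqxx.
Qed.

(** Multiplying [x] in [A_ g] by [X g^-1] lands in the neutral component, a copy
    of the complex numbers; multiplying back by [X g] recovers [x] up to the
    nonzero scalar [u] representing [X g^-1 * X g]. *)
Lemma homogeneous_complex_line g x :
  x \in A_ g <-> exists z, x = e z * X g.
Proof.
split=> [xg|[z ->]]; last first.
  by rewrite -[g in A_ g]mul1g (grading_mul gd) ?complex_embed_mem1.
have [u uE] : exists u, X g^-1%g * X g = e u.
  by apply: J_span; rewrite -(mulVg g) (grading_mul gd).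
have [w wE] : exists w, x * X g^-1%g = e w.
  by apply: J_span; rewrite -(mulgV g) (grading_mul gd).
have u0 : u != 0.
  by rewrite -complex_embed_eq0 -uE (homogeneous_mulf_neq0 gd (XA _)).
exists (w / u); rewrite [w / u]mulrC complex_embedM // -mulrA -wE -mulrA uE.
rewrite mulrA complex_embedC // -mulrA -complex_embedM // mulVf //.
by rewrite complex_embed1 mulr1.
Qed.

End ComplexStructure.

Lemma graded_division_complex (R : realType) (gT : finGroupType)
    (abelG : abelian [set: gT]) (A : falgType R) (A_ : gT -> {vspace A}) :
  graded_division_algebra A_ -> \dim (A_ 1%g) = 2%N ->
  (forall x y : A, x \in A_ 1%g -> x * y = y * x) ->
  exists beta : gT -> gT -> R[i], alternating_bicharacter beta /\
    exists (P : falgType R[i]) (P_ : gT -> {vspace P}),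
      is_P beta P_ /\ graded_isomorphic (fun g => A_ g) (real_component P_).
Proof.
move=> gd dim2 A1C; have [J [JA J2 J_span]] := imaginary_unit gd dim2.
have JC x : J * x = x * J by apply: A1C.
have [X XP] := homogeneous_generators gd.
have XA g := (XP g).1; have X0 g := (XP g).2.
pose B := complexification J2 JC.
have lineP := homogeneous_complex_line gd JA J2 JC J_span XA X0.
have X_span (x : B) : exists c : gT -> R[i], x = \sum_g c g *: (X g : B).
  have [u uA ->] := homogeneous_decomposition gd x.
  have /choice[c cE] : forall g, exists z, u g = complex_embed J z * X g.
    by move=> g; apply/lineP.
  by exists c; apply: eq_bigr => g _; apply: cE.
have X_free (c : gT -> R[i]) : \sum_g c g *: (X g : B) = 0 -> forall g, c g = 0.
  move=> c0 g; apply/eqP; rewrite -(complex_embed_eq0 J2).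
  have cX : complex_embed J (c g) * X g = 0.
    apply: (homogeneous_sum_eq0 gd
      (u := fun g => complex_embed J (c g) * X g)) => // h.
    by apply/lineP; exists (c h).
  have Xu := grading_unit gd (XA g) (X0 g).
  by rewrite -(mulrK Xu (complex_embed J (c g))) cX mul0r.
pose P : falgType R[i] :=
  HB.pack B
    (Lmodule_hasFinDim.Build R[i] B (vector_axiom_of_basis X_span X_free)).
pose P_ g : {vspace P} := <[X g : P]>%VS.
have memP g (x : P) : x \in P_ g <-> (x : A) \in A_ g.
  split=> [/vlineP[c ->]|/lineP[c ->]]; first by apply/lineP; exists c.
  by apply/vlineP; exists c.
have gdP : graded_division_algebra P_.
  split=> [||g h x y|g x|g].
  - apply/vspaceP=> x; rewrite memvf; apply/memv_sumP.
    have [u uA ->] := homogeneous_decomposition gd x.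
    by exists u => // g _; apply/memP.
  - apply/directv_sum_independent=> u uP u0 g _.
    by apply: (homogeneous_sum_eq0 gd _ u0) => h; apply/memP; apply: uP.
  - by move=> /memP xg /memP yh; apply/memP; apply: (grading_mul gd).
  - by move=> /memP; apply: (grading_unit gd).
  - rewrite -dimv_eq0 dim_vline.
    by have -> : (X g : P) != 0 by apply: X0.
have XPP g : (X g : P) != 0 /\ P_ g = <[X g : P]>%VS by split=> //; apply: X0.
have [sigma [sigma0 XM]] := hbasis_mul gdP XPP.
pose beta g h := sigma g h / sigma h g.
have XC g h : (X g : P) * (X h : P) = beta g h *: ((X h : P) * (X g : P)).
  by rewrite !XM scalerA divfK // (mulgC_abelian abelG).
exists beta; split; last first.
  exists P, P_; split; first by split=> //; exists X.
  have f_lin : linear (fun x : A => x : realification P).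
    move=> a x y; congr (_ + _).
    rewrite [RHS](_ : _ = complex_embed J a%:C * x) //.
    by rewrite complex_embed_real mulr_algl.
  have [phi phiE] := lrmorphism_of_fun f_lin (fun x y => erefl) erefl.
  exists phi; split=> [|g y].
    by exists id => x; rewrite ?phiE //=; apply: phiE.
  split=> [/memP yg|[x xg <-]]; first by exists y.
  by rewrite phiE; apply/memP.
have betaV g h : beta g h = (beta h g)^-1 by rewrite /beta invf_div.
have betaM := hbasis_commutation_mull gdP XPP XC.
split=> [g h|//|g h h'|g]; last exact: divff.
- by rewrite mulf_neq0 // invr_eq0.
- by rewrite betaV betaM invfM -!betaV.
Qed.

(** * The classification *)

Theorem theorem5p1 (R : realType) (gT : finGroupType)
    (abelG : abelian [set: gT]) :
  [/\ (forall (A : falgType R) (A_ : gT -> {vspace A}),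
         graded_division_algebra A_ ->
         \dim (A_ 1%g) = 2%N ->
         (forall x y : A, x \in A_ 1%g -> x * y = y * x) ->
         exists beta : gT -> gT -> R[i],
           alternating_bicharacter beta /\
           exists (P : falgType R[i]) (P_ : gT -> {vspace P}),
             is_P beta P_ /\
             graded_isomorphic (fun g => A_ g) (real_component P_)),
      (forall beta beta' : gT -> gT -> R[i],
         alternating_bicharacter beta -> alternating_bicharacter beta' ->
         forall (P : falgType R[i]) (P_ : gT -> {vspace P})
                (P' : falgType R[i]) (P'_ : gT -> {vspace P'}),
           is_P beta P_ -> is_P beta' P'_ ->
           (graded_isomorphic (real_component P_) (real_component P'_) <->
            beta' =2 beta \/ beta' =2 conj_bichar beta))
    & (forall beta beta' : gT -> gT -> R[i],
         alternating_bicharacter beta -> alternating_bicharacter beta' ->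
         forall (P : falgType R[i]) (P_ : gT -> {vspace P})
                (P' : falgType R[i]) (P'_ : gT -> {vspace P'}),
           is_P beta P_ -> is_P beta' P'_ ->
           (graded_equivalent (real_component P_) (real_component P'_) <->
            in_Aut_orbit beta' beta \/ in_Aut_orbit beta' (conj_bichar beta)))].
Proof.
split=> [A A_|beta beta' _ _ P P_ P' P'_ isP isP'|].
- exact: graded_division_complex.
- exact: (realification_iso_criterion abelG isP isP' (alpha := id)).
move=> beta beta' _ _ P P_ P' P'_ isP isP'; split.
- case=> alpha [phi [/isomP[inj_a im_a] phi_iso]].
  have a_inj : injective alpha by move=> g h; apply: (injmP inj_a); rewrite inE.
  have aM : {morph alpha : g h / (g * h)%g} by move=> g h; rewrite morphM ?inE.
  pose a := aut inj_a im_a.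
  have aE g : a g = alpha g by rewrite autE ?inE.
  have orbitE gamma : (forall g h, beta' (alpha g) (alpha h) = gamma g h) ->
      in_Aut_orbit beta' gamma.
    move=> gammaE; exists a^-1%g; first by rewrite groupV Aut_aut.
    by move=> g h; rewrite /aut_bichar invgK !aE gammaE.
  have [bE|bE] := (realification_iso_criterion abelG isP isP' aM a_inj).1
    (ex_intro _ phi phi_iso); [left|right]; exact: orbitE.
- have orbit_iso gamma : in_Aut_orbit beta' gamma ->
    exists alpha : {morphism [set: gT] >-> gT},
      isom [set: gT] [set: gT] alpha /\
      forall g h, beta' (alpha g) (alpha h) = gamma g h.
    case=> a aA gammaE; have aVA : a^-1%g \in Aut [set: gT] by rewrite groupV.
    exists (autm aVA); split=> [|g h]; last by rewrite gammaE.
    by apply/isomP; split; [exact: injm_autm|exact: im_autm].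
  have equiv (alpha : {morphism [set: gT] >-> gT}) :
      isom [set: gT] [set: gT] alpha ->
      (forall g h, beta' (alpha g) (alpha h) = beta g h) \/
      (forall g h, beta' (alpha g) (alpha h) = (beta g h)^*) ->
      graded_equivalent (real_component P_) (real_component P'_).
    move=> iso_a; have [inj_a _] := isomP iso_a.
    have a_inj : injective alpha by move=> g h; apply: (injmP inj_a); rewrite inE.
    have aM : {morph alpha : g h / (g * h)%g} by move=> g h; rewrite morphM ?inE.
    case/(realification_iso_criterion abelG isP isP' aM a_inj) => phi phi_iso.
    by exists alpha, phi.
  by case=> /orbit_iso[alpha [iso_a bE]]; apply: equiv iso_a _; [left|right].
Qed.
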